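(* Let $(X,\mathcal{A},\mu)$ be a measure space and let $I$ be an ideal of the ring $\mathcal{M}(X,\mathcal{A})$ such that $Z[I]$ is closed under countable intersection and $\mu(E)>0$ for each $E\in Z[I]$. Then the pseudonormed linear space $(L_I^\infty(\mu),\|\cdot\|_I^\infty)$ is complete.
   Context: $X$ is a non-empty set, $\mathcal{A}$ a $\sigma$-algebra on $X$, and $\mu:\mathcal{A}\to[0,\infty]$ a measure. $\mathcal{M}(X,\mathcal{A})$ is the commutative ring with unity of all real-valued $\mathcal{A}$-measurable functions on $X$, with pointwise operations. For $g\in\mathcal{M}(X,\mathcal{A})$, $Z(g)=\{x\in X: g(x)=0\}$, and for an ideal $I$, $Z[I]=\{Z(g): g\in I\}$. Null sets $E$ in the following definition are always members of $\mathcal{A}$. A function $f\in\mathcal{M}(X,\mathcal{A})$ is essentially $I$-bounded on $X$ if there exist $Z\in Z[I]$, $E\subseteq Z$ with $\mu(E)=0$, and a real number $\lambda>0$ such that $|f(x)|\le\lambda$ for all $x\in Z\setminus E$; any such $\lambda$ is called an essential $I$-upper bound of $f$ over $X$. $L_I^\infty(\mu)$ is the real vector space of all essentially $I$-bounded functions in $\mathcal{M}(X,\mathcal{A})$. For $f\in L_I^\infty(\mu)$, $\|f\|_I^\infty$ is the infimum of the set of all essential $I$-upper bounds of $f$; it is a pseudonorm (seminorm) on $L_I^\infty(\mu)$. Complete means that every sequence that is Cauchy with respect to $\|\cdot\|_I^\infty$ converges, with respect to $\|\cdot\|_I^\infty$, to some element of $L_I^\infty(\mu)$. *)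

(* Defs.v *)
From HB Require Import structures.
From mathcomp Require Import all_boot all_order all_algebra.
From mathcomp Require Import all_classical all_reals all_analysis.
From mathcomp Require Import measurable_realfun.

Set Implicit Arguments.
Unset Strict Implicit.
Unset Printing Implicit Defensive.

Import Order.TTheory GRing.Theory Num.Theory.
Import numFieldNormedType.Exports.

Local Open Scope classical_set_scope.
Local Open Scope ring_scope.

(* The library's [idealr_closed] only covers proper ideals; properness is not
   required here. *)
Definition is_ideal (A : comPzRingType) (I : set A) : Prop :=
  [/\ I 0,
      forall f g, I f -> I g -> I (f + g) &
      forall h f, I f -> I (h * f)].

Section ess_bounded.
Context d (X : measurableType d) (R : realType).
Variables (mu : {measure set X -> \bar R}) (I : set {mfun X >-> R}).
Implicit Types f g : {mfun X >-> R}.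

Definition zero_set g : set X := [set x | g x = 0].

Definition zero_sets : set (set X) := zero_set @` I.

Definition ess_upper_bound f (l : R) : Prop :=
  0 < l /\
  exists Z E : set X,
    [/\ zero_sets Z, E `<=` Z, measurable E, mu E = 0%E &
        forall x, (Z `\` E) x -> `|f x| <= l].

Definition Linfty : set {mfun X >-> R} := [set f | exists l, ess_upper_bound f l].

(* [inf] is the infimum in [R], and defaults to 0 on the empty set; the set is
   nonempty exactly when [f] is in [Linfty]. *)
Definition Linfty_norm f : R := inf [set l | ess_upper_bound f l].

End ess_bounded.

Section complete.
Context (R : realType) (V : lmodType R).
Variables (L : set V) (N : V -> R).

Definition cauchy_for (u : nat -> V) : Prop :=
  forall e : R, 0 < e ->
    exists n0 : nat, forall m n : nat, (n0 <= m)%N -> (n0 <= n)%N ->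
      N (u m - u n) < e.

Definition complete_for : Prop :=
  forall u : nat -> V, (forall n, L (u n)) -> cauchy_for u ->
    exists2 f : V, L f & N (u n - f) @[n --> \oo] --> (0 : R).

End complete.

Section Linfty_seminormed.
Context d (X : measurableType d) (R : realType).
Variables (mu : {measure set X -> \bar R}) (I : set {mfun X >-> R}).
Hypothesis idI : is_ideal I.
Implicit Types f g : {mfun X >-> R}.

Local Notation ub := (ess_upper_bound mu I).
Local Notation L := (Linfty mu I).
Local Notation N := (Linfty_norm mu I).

Lemma zero_setsI A B :
  zero_sets I A -> zero_sets I B -> zero_sets I (A `&` B).
Proof.
case: idI => _ ID IM [f If <-] [g Ig <-].
exists (f * f + g * g); first by apply: ID; exact: IM.
apply/seteqP; split => x; rewrite /zero_set/=.
  move=> /eqP; rewrite paddr_eq0 -?expr2 ?sqr_ge0// !sqrf_eq0.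
  by move=> /andP[/eqP ? /eqP ?].
move=> [fx gx]; change (f x * f x + g x * g x = 0).
by rewrite fx gx mulr0 addr0.
Qed.

Lemma ess_upper_boundD f g k l : ub f k -> ub g l -> ub (f + g) (k + l).
Proof.
move=> [k0 [Z [E [ZZ EZ mE E0 fk]]]] [l0 [Y [F [ZY FY mF F0 gl]]]].
split; first exact: addr_gt0.
exists (Z `&` Y), ((Z `&` Y) `&` (E `|` F)).
have mz W : zero_sets I W -> measurable W.
  move=> [h _ <-]; have := measurable_funPT h measurableT _ (measurable_set1 0).
  by rewrite setTI.
have mZY : measurable (Z `&` Y) by apply: measurableI; exact: mz.
have mEF : measurable (E `|` F) by exact: measurableU.
split; [exact: zero_setsI|by move=> x []|exact: measurableI| |].
  apply: (@subset_measure0 _ _ _ mu _ (E `|` F)) => //.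
  - exact: measurableI.
  - apply/eqP; rewrite -measure_le0; apply: (le_trans (measureU2 mu mE mF)).
    by rewrite [X in (X + _)%E]E0 [X in (_ + X)%E]F0 adde0.
move=> x [[Zx Yx] nEF]; apply: (le_trans (ler_normD _ _)).
apply: lerD; [apply: fk|apply: gl]; split => //.
  by move=> Ex; apply: nEF; split => //; left.
by move=> Fx; apply: nEF; split => //; right.
Qed.

Lemma ess_upper_boundZ (a : R) f l e : 0 < e -> ub f l ->
  ub (a *: f) (`|a| * l + e).
Proof.
move=> e0 [l0 [Z [E [ZZ EZ mE E0 fl]]]]; split.
  by apply: ltr_wpDl => //; rewrite mulr_ge0// ltW.
exists Z, E; split => // x ZEx.
have -> : (a *: f) x = a * f x by [].
rewrite normrM; apply: ler_wpDr; first exact: ltW.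
by rewrite ler_wpM2l// fl.
Qed.

Lemma ess_upper_bound0 e : 0 < e -> ub 0 e.
Proof.
move=> e0; split => //; case: idI => I0 _ _.
exists (zero_set (0 : {mfun X >-> R})), set0; split => //.
  by exists 0.
by move=> x _; rewrite normr0 ltW.
Qed.

Lemma Linfty_submod : GRing.submod_closed (mem L).
Proof.
split; first by rewrite inE; exists 1; exact: ess_upper_bound0.
move=> a f g; rewrite !inE => -[k fk] [l gl].
exists (`|a| * k + 1 + l); apply: ess_upper_boundD => //.
exact: ess_upper_boundZ.
Qed.

Let lb f : lbound [set l | ub f l] 0.
Proof. by move=> l [/ltW]. Qed.

Lemma Linfty_norm_le f l : ub f l -> N f <= l.
Proof. by move=> fl; apply: ge_inf => //; exists 0; exact: lb. Qed.

Lemma Linfty_norm_adherent f e : 0 < e -> L f -> exists2 l, ub f l & l < N f + e.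
Proof.
move=> e0 [l fl].
by apply: inf_adherent => //; split; [exists l|exists 0; exact: lb].
Qed.

Lemma Linfty_norm_ge0 f : L f -> 0 <= N f.
Proof. by move=> [l fl]; apply: lb_le_inf; [exists l|exact: lb]. Qed.

Lemma Linfty_normD f g : L f -> L g -> N (f + g) <= N f + N g.
Proof.
move=> Lf Lg; apply/ler_addgt0Pr => e e0.
have e2 : 0 < e / 2 by rewrite divr_gt0.
have [k fk kf] := Linfty_norm_adherent e2 Lf.
have [l gl lg] := Linfty_norm_adherent e2 Lg.
apply: (le_trans (Linfty_norm_le (ess_upper_boundD fk gl))).
by rewrite (splitr e) addrACA lerD// ltW.
Qed.

Let normZ_le (a : R) f : L f -> N (a *: f) <= `|a| * N f.
Proof.
move=> Lf; apply/ler_addgt0Pr => e e0.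
have e2 : 0 < e / 2 by rewrite divr_gt0.
have a1 : 0 < `|a| + 1 by rewrite ltr_wpDl.
have [k fk kf] := Linfty_norm_adherent (divr_gt0 e2 a1) Lf.
apply: (le_trans (Linfty_norm_le (ess_upper_boundZ a e2 fk))).
rewrite [X in _ <= _ + X](splitr e) addrA lerD2r.
apply: (le_trans (ler_wpM2l (normr_ge0 a) (ltW kf))).
rewrite mulrDr lerD2l mulrCA -[leRHS]mulr1 ler_wpM2l ?ltW//.
by rewrite ltr_pdivrMr// mul1r ltrDl.
Qed.

Lemma Linfty_normZ (a : R) f : L f -> N (a *: f) = `|a| * N f.
Proof.
move=> Lf; apply/eqP; rewrite eq_le normZ_le//=.
have [->|a0] := eqVneq a 0.
  rewrite normr0 mul0r; apply: Linfty_norm_ge0.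
  by rewrite scale0r; exists 1; exact: ess_upper_bound0.
rewrite mulrC -ler_pdivlMr ?normr_gt0// mulrC -normfV.
rewrite -{1}[f]scale1r -(mulVf a0) -scalerA; apply: normZ_le.
by case: Lf => l fl; exists (`|a| * l + 1); exact: ess_upper_boundZ.
Qed.

End Linfty_seminormed.

(* Main.v *)
Require Import Defs.
From HB Require Import structures.
From mathcomp Require Import all_boot all_order all_algebra.
From mathcomp Require Import all_classical all_reals all_analysis.
From mathcomp Require Import measurable_realfun.
Import Order.TTheory GRing.Theory Num.Theory.
Import numFieldNormedType.Exports.
Local Open Scope classical_set_scope.
Local Open Scope ring_scope.

(** Completeness reduces to the completeness of R at each point of one good
set.  Say that a property holds I-almost everywhere when it holds on some
zero set Z of I outside a null subset of Z; an essential I-upper bound of f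
is then a positive l such that |f| <= l holds I-almost everywhere.  Closure
of Z[I] under countable intersection, with the countable subadditivity of
mu, lets countably many I-almost everywhere statements hold simultaneously
([I_ae_forall]).

A first consequence is that the infimum defining the seminorm is attained:
|f| <= ||f|| holds I-almost everywhere ([I_ae_le_norm]).  A second one is
that, for a Cauchy sequence u, the inequalities |u_m - u_n| <= ||u_m - u_n||
hold for all m and n at once, I-almost everywhere.  Where they all hold, the
real sequence u_n(x) is Cauchy, hence convergent; replacing the u_n by 0
elsewhere gives a pointwise convergent sequence of measurable functions,
whose limit f is measurable ([I_ae_limit]).  Letting m tend to infinity in
|u_m - u_n| <= e shows that e is an essential I-upper bound of u_n - f for n
large, so f = u_n - (u_n - f) is essentially I-bounded and u_n tends to f. *)

Definition I_ae {d : measure_display} {X : measurableType d} {R : realType}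
    (mu : {measure set X -> \bar R}) (I : set {mfun X >-> R})
    (P : set X) : Prop :=
  exists Z E : set X,
    [/\ zero_sets I Z, E `<=` Z, measurable E, mu E = 0%E &
        Z `\` E `<=` P].

Lemma measurable_zero_sets {d : measure_display} {X : measurableType d}
    {R : realType} {I : set {mfun X >-> R}} (Z : set X) :
  zero_sets I Z -> measurable Z.
Proof.
move=> [h _ <-]; have := measurable_funPT h measurableT _ (measurable_set1 0).
by rewrite setTI.
Qed.

Lemma I_aeS {d : measure_display} {X : measurableType d} {R : realType}
    {mu : {measure set X -> \bar R}} {I : set {mfun X >-> R}} (P Q : set X) :
  P `<=` Q -> I_ae mu I P -> I_ae mu I Q.
Proof.
move=> PQ [Z [E [ZZ EZ mE E0 ZEP]]]; exists Z, E; split => //.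
exact: subset_trans PQ.
Qed.

(** The exceptional set is cut down to the intersection of the zero sets,
since a witness must lie inside its zero set; it stays null as a subset of a
countable union of null sets. *)
Lemma I_ae_forall {d : measure_display} {X : measurableType d} {R : realType}
    {mu : {measure set X -> \bar R}} {I : set {mfun X >-> R}}
    (capI : forall F : nat -> set X,
      (forall n, zero_sets I (F n)) -> zero_sets I (\bigcap_n F n))
    (P : nat -> set X) :
  (forall n, I_ae mu I (P n)) -> I_ae mu I (\bigcap_n P n).
Proof.
move=> /choice[Z /choice[E ZE]].
have ZZ : zero_sets I (\bigcap_n Z n) by apply: capI => n; case: (ZE n).
have mZ := measurable_zero_sets _ ZZ.
have mE : measurable (\bigcup_n E n).
  by apply: bigcup_measurable => n _; case: (ZE n).
exists (\bigcap_n Z n), (\bigcap_n Z n `&` \bigcup_n E n); split => //.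
- exact: measurableI.
- apply: measure_negligible; first exact: measurableI.
  apply: (@negligibleS _ _ _ mu (\bigcup_n E n)); first exact: subIsetr.
  apply: negligible_bigcup => n; have [_ _ mEn En0 _] := ZE n.
  by exists (E n); split.
- move=> x [Zx nEx] n _; have [_ _ _ _] := ZE n; apply; split; first exact: Zx.
  by move=> Enx; apply: nEx; split => //; exists n.
Qed.

(** The essential I-upper bounds ||f|| + 1/(k+1) are countably many, so they
hold simultaneously. *)
Lemma I_ae_le_norm {d : measure_display} {X : measurableType d} {R : realType}
    {mu : {measure set X -> \bar R}} {I : set {mfun X >-> R}}
    (capI : forall F : nat -> set X,
      (forall n, zero_sets I (F n)) -> zero_sets I (\bigcap_n F n))
    (f : {mfun X >-> R}) :
  Linfty mu I f -> I_ae mu I [set x | `|f x| <= Linfty_norm mu I f].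
Proof.
move=> Lf.
have : I_ae mu I
    (\bigcap_k [set x | `|f x| <= Linfty_norm mu I f + k.+1%:R^-1]).
  apply: I_ae_forall => // k.
  have k0 : 0 < k.+1%:R^-1 :> R by rewrite invr_gt0.
  have [l [_ fl] lN] := Linfty_norm_adherent k0 Lf.
  by apply: I_aeS fl => x /= /le_trans; apply; exact: ltW.
apply: I_aeS => x /= fx; apply/ler_addgt0Pr => e e0.
have /ltr_add_invr[k ke] : Linfty_norm mu I f < Linfty_norm mu I f + e.
  by rewrite ltrDl.
by apply: le_trans (ltW ke); exact: fx.
Qed.

(** Cutting the functions down to the measurable set Z \ E where they converge
keeps them measurable and makes them converge everywhere. *)
Lemma I_ae_limit {d : measure_display} {X : measurableType d} {R : realType}
    {mu : {measure set X -> \bar R}} {I : set {mfun X >-> R}}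
    (u : nat -> {mfun X >-> R}) :
  I_ae mu I [set x | cvg (u n x @[n --> \oo])] ->
  exists f : {mfun X >-> R}, I_ae mu I [set x | u n x @[n --> \oo] --> f x].
Proof.
move=> [Z [E [ZZ EZ mE E0 ZEu]]].
pose v n x : R := u n x * \1_(Z `\` E) x.
have vcvg x : cvg (v n x @[n --> \oo]).
  have [ZEx|ZEx] := pselect ((Z `\` E) x).
    apply: is_cvgM; last exact: is_cvg_cst.
    exact: ZEu.
  rewrite (_ : (fun n => v n x) = fun=> 0); first exact: is_cvg_cst.
  by apply/funext => n; rewrite /v indicE memNset// mulr0.
pose f x := lim (v n x @[n --> \oo]).
have mf : measurable_fun setT f.
  apply: (@measurable_fun_cvg _ _ _ setT v) => [n|x _]; last exact: vcvg.
  apply: measurable_funM => //; apply: measurable_indic.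
  by apply: measurableD => //; exact: measurable_zero_sets ZZ.
exists (mfun_Sub (mem_set mf)), Z, E; split => // x ZEx /=.
rewrite (_ : (fun n => u n x) = fun n => v n x); first exact: vcvg.
by apply/funext => n; rewrite /v indicE mem_set// mulr1.
Qed.

Theorem theorem4p2 (d : measure_display) (X : measurableType d) (R : realType)
    (mu : {measure set X -> \bar R}) (I : set {mfun X >-> R})
    (idI : is_ideal I)
    (capI : forall F : nat -> set X,
      (forall n, zero_sets I (F n)) -> zero_sets I (\bigcap_n F n))
    (posI : forall E : set X, zero_sets I E -> (0 < mu E)%E) :
  complete_for (Linfty mu I) (Linfty_norm mu I).
Proof.
move=> u Lu cu; pose N := Linfty_norm mu I.
have LB f g : Linfty mu I f -> Linfty mu I g -> Linfty mu I (f - g).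
  have [_ Llin] := Linfty_submod mu idI.
  move=> Lf Lg; apply: set_mem; rewrite addrC -scaleN1r.
  by apply: Llin; exact: mem_set.
pose G := \bigcap_m \bigcap_n [set x | `|(u m - u n) x| <= N (u m - u n)].
have aeG : I_ae mu I G.
  apply: I_ae_forall => // m; apply: I_ae_forall => // n.
  by apply: I_ae_le_norm => //; exact: LB.
have [f aef] : exists f : {mfun X >-> R},
    I_ae mu I [set x | u n x @[n --> \oo] --> f x].
  apply: I_ae_limit; apply: I_aeS aeG => x Gx /=.
  apply: cauchy_cvg; apply: cauchy_exP => e e0.
  have [n0 un0] := cu _ e0; exists (u n0 x).
  exists n0 => // n /= n0n; apply: le_lt_trans (un0 _ _ (leqnn _) n0n).
  exact: (Gx n0 Logic.I n Logic.I).
have aeGf : I_ae mu I (G `&` [set x | u n x @[n --> \oo] --> f x]).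
  pose P n := if n is 0%N then G else [set x | u n x @[n --> \oo] --> f x].
  apply: (@I_aeS _ _ _ _ _ (\bigcap_n P n)).
    by move=> x Px; split; [exact: (Px 0%N)|exact: (Px 1%N)].
  by apply: I_ae_forall => //; case.
(* Let m tend to infinity in |u_m x - u_n x| <= e. *)
have ubf e : 0 < e -> exists n0, forall n, (n0 <= n)%N ->
    ess_upper_bound mu I (u n - f) e.
  move=> e0; have [n0 un0] := cu _ e0; exists n0 => n n0n; split => //.
  apply: I_aeS aeGf => x [Gx ufx] /=.
  have cv : (`|u m x - u n x| @[m --> \oo]) --> `|f x - u n x|.
    by apply: cvg_norm; apply: cvgB => //; exact: cvg_cst.
  rewrite distrC; apply: cvgr_to_le cv _.
  exists n0 => // m /= n0m; apply: le_trans (ltW (un0 _ _ n0m n0n)).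
  exact: (Gx m Logic.I n Logic.I).
have Lf : Linfty mu I f.
  have [n0 /(_ _ (leqnn n0)) b1] := ubf 1 ltr01.
  by rewrite -[f](subKr (u n0)); apply: LB => //; exists 1.
exists f => //; apply/cvgrPdist_le => e e0; have [n0 ub] := ubf e e0.
exists n0 => // n /= n0n; rewrite sub0r normrN ger0_norm.
  exact: Linfty_norm_le (ub n n0n).
by apply: Linfty_norm_ge0; exact: LB.
Qed.
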